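(* Let $n\ge 2$ and let $\sigma_1\neq\sigma_2$ be permutations in $S_n$. Suppose $\sigma_1^{-1}\sigma_2$ is a product of $c$ disjoint cycles in $S_n$. Then the pair $P_{\sigma_1},P_{\sigma_2}$ is uniquely summable if and only if $c=1$. Furthermore, the matrix $P_{\sigma_1}+P_{\sigma_2}$ may be expressed in exactly $2^{c}$ ways as an ordered sum $P_{\tau_1}+P_{\tau_2}$ of two permutation matrices.
   Context: For $\sigma\in S_n$, $P_\sigma$ denotes the $n\times n$ permutation matrix of $\sigma$, with the convention $P_\sigma P_\tau=P_{\sigma\tau}$. A pair of distinct permutation matrices $P_{\sigma_1},P_{\sigma_2}$ is called uniquely summable if whenever $P_{\sigma_1}+P_{\sigma_2}=P_{\tau_1}+P_{\tau_2}$ for permutations $\tau_1,\tau_2$, we have either $\sigma_1=\tau_1,\sigma_2=\tau_2$, or $\sigma_1=\tau_2,\sigma_2=\tau_1$. In the cycle decomposition, $c$ counts the nontrivial cycles (fixed points are not counted as cycles). *)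

(* Defs.v *)
From HB Require Import structures.
From mathcomp Require Import all_boot all_order all_fingroup all_algebra.

Set Implicit Arguments.
Unset Strict Implicit.
Unset Printing Implicit Defensive.

Import GRing.Theory Num.Theory.
Local Open Scope ring_scope.

(* P_s is the library's [perm_mx s], whose (i, j) entry is 1 iff [s i = j].
   Products of permutations are read left to right, (s * t) x = t (s x), so
   that [perm_mxM] gives P_s P_t = P_(s * t). *)

(* [porbits s] also contains the fixed points of [s], as singletons. *)
Definition num_cycles (T : finType) (s : {perm T}) : nat :=
  #|[set C in porbits s | (1 < #|C|)%N]|.

(* Meant for [s1 != s2].  Entries lie in a ring of characteristic 0: over
   'F_2 the sum of two permutation matrices carries less information. *)
Definition uniquely_summable (R : numDomainType) (n : nat) (s1 s2 : 'S_n) :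
    Prop :=
  forall t1 t2 : 'S_n,
    perm_mx s1 + perm_mx s2 = perm_mx t1 + perm_mx t2 :> 'M[R]_n ->
    (s1 = t1 /\ s2 = t2) \/ (s1 = t2 /\ s2 = t1).

Definition ordered_sums (R : numDomainType) (n : nat) (A : 'M[R]_n) :
    {set 'S_n * 'S_n} :=
  [set t : 'S_n * 'S_n | A == perm_mx t.1 + perm_mx t.2].

Arguments uniquely_summable R {n} s1 s2.

(* Main.v *)
(* With p = s1^-1 s2, a decomposition t1, t2 of P_s1 + P_s2 satisfies
   {t1 i, t2 i} = {s1 i, s2 i} for every i, so u = s1^-1 t1 sends each y to y
   or to p y.  Injectivity of u makes {y | u y = p y} stable under p, so u is
   p on some of the nontrivial cycles of p and the identity elsewhere; any of
   the 2^c sets of nontrivial cycles occurs.  The pair is uniquely summable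
   iff there are only the two decompositions (s1, s2) and (s2, s1). *)

Require Import Defs.
From HB Require Import structures.
From mathcomp Require Import all_boot all_order all_fingroup all_algebra.

Set Implicit Arguments.
Unset Strict Implicit.
Unset Printing Implicit Defensive.

Import GRing.Theory Num.Theory.
Local Open Scope ring_scope.

Lemma porbit_image (T : finType) (p : {perm T}) (x : T) : p x \in porbit p x.
Proof. by have := mem_porbit p 1 x; rewrite expg1. Qed.

Lemma card_porbit_gt1 (T : finType) (p : {perm T}) (x : T) :
  (1 < #|porbit p x|)%N = (p x != x).
Proof.
have [px | npx] := eqVneq (p x) x; last first.
  by apply/card_gt1P; exists (p x), x; rewrite ?porbit_id // porbit_image.
apply/negbTE; rewrite -leqNgt -(cards1 x) subset_leq_card //.
apply/subsetP=> _ /porbitP[i ->]; rewrite inE permX.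
by elim: i => //= i /eqP ->; rewrite px.
Qed.

Lemma porbit_stable (T : finType) (p : {perm T}) (P : pred T) (x y : T) :
  (forall z, P z -> P (p z)) -> y \in porbit p x -> P x -> P y.
Proof.
move=> stP /porbitP[i ->] Px; rewrite permX.
by elim: i => //= i; apply: stP.
Qed.

Section SubproductOfCycles.

Variables (T : finType) (p : {perm T}).
Implicit Types (X Y : {set {set T}}) (x y : T) (u : {perm T}).

(** [X] may be any set of subsets of [T]: members that are not orbits, and singleton orbits, have no
    effect. This lets [~: X] stand for the remaining cycles. *)
Definition cycles_fun X x := if porbit p x \in X then p x else x.

Lemma porbit_cycles_fun X x : porbit p (cycles_fun X x) = porbit p x.
Proof.
rewrite /cycles_fun; case: ifP => // _; apply/eqP.
by rewrite eq_porbit_mem porbit_image.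
Qed.

(** The map preserves orbits, so two points with the same image share an orbit and are both moved by
    [p] or both left in place. *)
Lemma cycles_fun_inj X : injective (cycles_fun X).
Proof.
move=> x y eqf; have := congr1 (porbit p) eqf.
rewrite !porbit_cycles_fun => eqo; move: eqf; rewrite /cycles_fun eqo.
by case: ifP => // _; apply: perm_inj.
Qed.

Definition cycles_perm X : {perm T} := perm (@cycles_fun_inj X).

Lemma cycles_permE X x :
  cycles_perm X x = if porbit p x \in X then p x else x.
Proof. by rewrite permE. Qed.

Definition nontrivial_cycles := [set C in porbits p | (1 < #|C|)%N].

(** A nontrivial cycle is in [X] exactly when its points are moved. Singleton orbits must be
    excluded, as adding them to [X] changes nothing. *)
Lemma cycles_perm_inj : {in powerset nontrivial_cycles &, injective cycles_perm}.
Proof.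
suff sub X Y : X \subset nontrivial_cycles -> cycles_perm X = cycles_perm Y ->
    X \subset Y.
  move=> X Y; rewrite !powersetE => sX sY eqXY.
  by apply/eqP; rewrite eqEsubset (sub X Y) ?(sub Y X).
move=> /subsetP sX eqXY; apply/subsetP=> C CX.
have := sX C CX; rewrite inE => /andP[/imsetP[x _ defC]].
rewrite defC card_porbit_gt1 => npx.
have := congr1 (fun u : {perm T} => u x) eqXY; rewrite !cycles_permE -defC CX.
by case: ifP => // _ px; rewrite px eqxx in npx.
Qed.

Lemma cycles_perm_surj u : (forall x, u x = x \/ u x = p x) ->
  exists2 X, X \in powerset nontrivial_cycles & u = cycles_perm X.
Proof.
move=> uP; pose E := [pred x | u x == p x].
(* If [u] fixes [p x] while [u x = p x], injectivity of [u] forces [p x = x], and then [u] and [p]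
   agree at [p x] anyway. *)
have stE x : E x -> E (p x).
  rewrite /= => /eqP ux; case: (uP (p x)) => [upx | ->] //.
  have px : p x = x by apply: (@perm_inj _ u); rewrite upx ux.
  by rewrite !px ux px.
exists [set C in nontrivial_cycles | C \subset E].
  by rewrite powersetE; apply/subsetP=> C; rewrite inE => /andP[].
apply/permP=> x; rewrite cycles_permE !inE card_porbit_gt1 imset_f //=.
have [px | npx] := eqVneq (p x) x; first by case: (uP x) => ->.
case: ifPn => [/subsetP/(_ x (porbit_id p x))/eqP // | nsub].
(* Agreement of [u] with [p] at the single point [x] spreads by stability to its whole orbit, which
   would then have been selected. *)
case: (uP x) => // /eqP Ex; case/negP: nsub; apply/subsetP=> y xy.
exact: porbit_stable stE xy Ex.
Qed.

End SubproductOfCycles.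

Lemma perm_mx_addP (R : numDomainType) (n : nat) (s1 s2 t1 t2 : 'S_n) :
  reflect (forall i, (t1 i = s1 i /\ t2 i = s2 i) \/ (t1 i = s2 i /\ t2 i = s1 i))
    (perm_mx s1 + perm_mx s2 == perm_mx t1 + perm_mx t2 :> 'M[R]_n).
Proof.
apply: (iffP eqP) => [/matrixP eqA i | eqt]; last first.
  apply/matrixP=> i j; rewrite !mxE.
  by case: (eqt i) => -[-> ->] //; rewrite addrC.
(* Characteristic 0 turns the equality of entries in row [i] into one between natural numbers, so
   that overlaps are counted correctly. *)
have eqn j : ((s1 i == j) + (s2 i == j) = (t1 i == j) + (t2 i == j))%N.
  by apply/eqP; rewrite -(eqr_nat R) !natrD; have := eqA i j; rewrite !mxE => ->.
(* Three columns of row [i] suffice: [t1 i] must be [s1 i] or [s2 i], and counting in column [t2 i]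
   or [s1 i] then settles [t2 i]. *)
have := eqn (t2 i); have := eqn (s1 i); have := eqn (t1 i); rewrite !eqxx.
have [-> | _] := eqVneq (s1 i) (t1 i).
  by have [-> | _] := eqVneq (s2 i) (t2 i); [auto | case: (t1 i == t2 i)].
have [-> | //] := eqVneq (s2 i) (t1 i).
by have [-> | //] := eqVneq (t2 i) (s1 i); auto.
Qed.

(** The second summand takes the cycles that the first leaves out: where [t1] follows [s2], [t2]
    follows [s1], and conversely. *)
Lemma ordered_sumsE (R : numDomainType) (n : nat) (s1 s2 : 'S_n) :
  let p := (s1^-1 * s2)%g in
  ordered_sums (perm_mx s1 + perm_mx s2 : 'M[R]_n) =
    [set ((s1 * cycles_perm p X)%g, (s1 * cycles_perm p (~: X))%g)
      | X in powerset (nontrivial_cycles p)].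
Proof.
move=> p; have ps1 i : p (s1 i) = s2 i by rewrite permM permK.
apply/setP=> -[t1 t2]; rewrite inE /=.
apply/perm_mx_addP/imsetP => [tP | [X _ [-> ->]] i]; last first.
  rewrite !permM !cycles_permE inE ps1.
  by case: (_ \in X); auto.
have [x | X XN defu] := @cycles_perm_surj _ p (s1^-1 * t1)%g.
  (* Writing [x] as [s1 y] with [y = s1^-1 x], the two allowed values [s1 y] and [s2 y] of [t1 y]
     become [x] and [p x]. *)
  rewrite -(permKV s1 x) ps1 !permM permK.
  by case: (tP (s1^-1 x)%g) => -[-> _]; auto.
have deft1 : t1 = (s1 * cycles_perm p X)%g by rewrite -defu mulKVg.
exists X => //; congr pair => //; apply/permP=> i.
have := tP i; rewrite deft1 !permM !cycles_permE inE ps1.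
by case: (_ \in X) => /= -[] [? ?]; congruence.
Qed.

Lemma card_ordered_sums (R : numDomainType) (n : nat) (s1 s2 : 'S_n) :
  #|ordered_sums (perm_mx s1 + perm_mx s2 : 'M[R]_n)|
    = (2 ^ num_cycles (s1^-1 * s2)%g)%N.
Proof.
(* The first component of a pair already determines [X]. *)
rewrite ordered_sumsE card_in_imset ?card_powerset // => X Y XN YN.
by case=> /mulgI eqXY _; apply: cycles_perm_inj eqXY.
Qed.

(** The sums [(s1, s2)] and [(s2, s1)] always occur and differ because [s1 <> s2], so uniqueness
    means that the set has no third element. *)
Lemma uniquely_summableP (R : numDomainType) (n : nat) (s1 s2 : 'S_n) :
  s1 <> s2 ->
  uniquely_summable R s1 s2 <->
    #|ordered_sums (perm_mx s1 + perm_mx s2 : 'M[R]_n)| = 2.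
Proof.
move=> /eqP neq_s; set S := ordered_sums _; pose D := [set (s1, s2); (s2, s1)].
have cardD : #|D| = 2 by rewrite cards2 xpair_eqE negb_and neq_s.
have DS : D \subset S.
  apply/subsetP=> t; rewrite !inE.
  by case/orP=> /eqP -> /=; rewrite // addrC.
rewrite -cardD; split=> [us | cardS t1 t2 /eqP eqA].
  congr #|pred_of_set _|; apply/eqP; rewrite eqEsubset DS andbT.
  apply/subsetP=> -[t1 t2]; rewrite inE /= => /eqP /us.
  by case=> -[<- <-]; rewrite !inE eqxx ?orbT.
have /eqP defS : D == S by rewrite eqEcard DS cardS leqnn.
have : (t1, t2) \in D by rewrite defS inE.
by rewrite !inE => /orP[] /eqP[-> ->]; auto.
Qed.

Theorem theorem4p2 (R : numDomainType) (n : nat) (n_ge2 : (2 <= n)%N)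
    (s1 s2 : 'S_n) (neq_s : s1 <> s2) (c : nat)
    (s_cycles : num_cycles (s1^-1 * s2)%g = c) :
  (uniquely_summable R s1 s2 <-> c = 1%N) /\
  #|ordered_sums (perm_mx s1 + perm_mx s2 : 'M[R]_n)| = (2 ^ c)%N.
Proof.
rewrite -s_cycles; split; last exact: card_ordered_sums.
apply: (iff_trans (uniquely_summableP R neq_s)); rewrite card_ordered_sums.
by split=> [/eqP | -> //]; rewrite -[X in _ == X](expn1 2) eqn_exp2l // => /eqP.
Qed.
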